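(* Let $q$ be a prime power and let $a,b$ be integers with $0\le b\le a\le q-2$. Let $\square\subset\mathbb R^2$ be the convex polytope with vertices $(0,0),(a,0),(b,q-2),(0,q-2)$, and let $U=\mathbb Z^2\cap\square$ be the set of lattice points in $\square$. Let $\mathcal M(U)$ be the linear secret sharing scheme with support $T(\mathbb F_q)=(\mathbb F_q^* )^2$ and $n=(q-1)^2-1$ players. Then: (i) For every nonzero $f\in\mathbb F_q\langle U\rangle$, the number of zeros of $f$ on $T(\mathbb F_q)$ is at most $(q-1)^2-(q-1-a)$. (ii) The reconstruction threshold of $\mathcal M(U)$ satisfies $r(U)\le 1+(q-1)^2-(q-1-a)$. (iii) The privacy threshold of $\mathcal M(U)$ satisfies $t(U)\ge b-1$. (iv) If $2a\le q-2$, then $\mathcal M(U)$ has $t$-strong multiplication for every $t\le\min\{b-1,\,(q-2-2a)-1\}$.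
   Context: $\mathbb F_q$ is the finite field with $q$ elements, $\mathbb F_q^*=\mathbb F_q\setminus\{0\}$, and $T(\mathbb F_q)=(\mathbb F_q^* )^2$. For $U\subseteq\mathbb Z^2$, $\mathbb F_q\langle U\rangle$ denotes the $\mathbb F_q$-linear span in $\mathbb F_q[X_1^{\pm1},X_2^{\pm1}]$ of the monomials $X_1^{u_1}X_2^{u_2}$, $(u_1,u_2)\in U$. The scheme $\mathcal M(U)$ with support $T(\mathbb F_q)$: fix a point $P_0\in T(\mathbb F_q)$. The players are the $n=|T(\mathbb F_q)|-1$ points of $T(\mathbb F_q)\setminus\{P_0\}$. To share a secret $s_0\in\mathbb F_q$, choose $f\in\mathbb F_q\langle U\rangle$ at random subject to $f(P_0)=s_0$; the share of player $P$ is $f(P)$. A set $A$ of players determines the secret if, for $f\in\mathbb F_q\langle U\rangle$, the value $f(P_0)$ is uniquely determined by the values $(f(P))_{P\in A}$, i.e. if any two $f,f'\in\mathbb F_q\langle U\rangle$ with $f(P)=f'(P)$ for all $P\in A$ satisfy $f(P_0)=f'(P_0)$. The reconstruction threshold $r(U)$ is the smallest integer $r$ such that every set of at least $r$ players determines the secret. The privacy threshold $t(U)$ is the largest integer $t\le n$ such that no set of $t$ or fewer players determines the secret. The scheme has $t$-strong multiplication (strong multiplication with respect to the adversary structure $\mathcal A_{t,n}$ of all sets of at most $t$ players) if (1) no set of at most $t$ players determines the secret, and (2) for every set $A$ of at most $t$ players and all $f,g\in\mathbb F_q\langle U\rangle$, the products of shares $f(P)g(P)$ for all players $P\notin A$ uniquely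 determine the product of secrets $f(P_0)g(P_0)$. *)

(* Defs.v *)
From HB Require Import structures.
From mathcomp Require Import all_boot all_order all_algebra.
From mathcomp Require Export reals.
From mathcomp Require Export monalg.

Set Implicit Arguments.
Unset Strict Implicit.
Unset Printing Implicit Defensive.

Import Order.TTheory GRing.Theory Num.Theory.

Local Open Scope ring_scope.

Definition conv_hull (R : realType) (V : lmodType R) (s : seq V) (x : V) : Prop :=
  exists w : 'I_(size s) -> R,
    [/\ forall i, 0 <= w i, \sum_i w i = 1 & x = \sum_i w i *: s`_i].

(* R^o carries the vector space structure of R over itself, so that
   R^o * R^o is the real plane. *)
Definition lattice_pt (R : realType) (u : int * int) : R^o * R^o :=
  (u.1%:~R, u.2%:~R).

Definition trapezoid (R : realType) (a b q : int) : R^o * R^o -> Prop :=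
  conv_hull [:: lattice_pt R (0, 0); lattice_pt R (a, 0);
                lattice_pt R (b, q - 2); lattice_pt R (0, q - 2)].
Arguments trapezoid R a b q _ : clear implicits.

Definition lattice_points (R : realType) (K : R^o * R^o -> Prop)
    (u : int * int) : Prop :=
  K (lattice_pt R u).

(* The vector space underlying F[X1^{+-1}, X2^{+-1}]: finitely supported
   functions Z^2 -> F, with << u >> the monomial X1^u.1 X2^u.2.  Neither the
   library's product on monoid algebras (Z^2 is not a monomType, having
   nontrivial units) nor any other product of Laurent polynomials is needed. *)
Definition laurent2 (F : fieldType) := {malg F[(int * int)%type]}.

Definition leval (F : fieldType) (f : laurent2 F) (P : F * F) : F :=
  mmap idfun (fun u : int * int => P.1 ^ u.1 * P.2 ^ u.2) f.

Definition monomial_span (F : fieldType) (U : int * int -> Prop)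
    (f : laurent2 F) : Prop :=
  exists n (c : 'I_n -> F) (u : 'I_n -> int * int),
    (forall i, U (u i)) /\ f = \sum_(i < n) c i *: << u i >>.

Definition torus (F : finFieldType) : {set F * F} :=
  [set P | (P.1 != 0) && (P.2 != 0)].

Definition players (F : finFieldType) (P0 : F * F) : {set F * F} :=
  torus F :\ P0.

Section Scheme.
Variables (F : finFieldType) (U : int * int -> Prop) (P0 : F * F).

Definition determines (A : {set F * F}) : Prop :=
  forall f f' : laurent2 F, monomial_span U f -> monomial_span U f' ->
    (forall P, P \in A -> leval f P = leval f' P) ->
    leval f P0 = leval f' P0.

(* Thresholds are integers, not naturals: -1 is a possible bound. *)
Definition reconstructs (r : int) : Prop :=
  forall A : {set F * F}, A \subset players P0 -> r <= #|A|%:Z -> determines A.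

Definition is_reconstruction_threshold (r : int) : Prop :=
  reconstructs r /\ (forall r', reconstructs r' -> r <= r').

Definition private (t : int) : Prop :=
  forall A : {set F * F}, A \subset players P0 -> #|A|%:Z <= t -> ~ determines A.

Definition is_privacy_threshold (t : int) : Prop :=
  [/\ t <= #|players P0|%:Z, private t &
      forall t', t' <= #|players P0|%:Z -> private t' -> t' <= t].

Definition product_reconstruction (t : int) : Prop :=
  forall A : {set F * F}, A \subset players P0 -> #|A|%:Z <= t ->
  forall f g f' g' : laurent2 F,
    monomial_span U f -> monomial_span U g ->
    monomial_span U f' -> monomial_span U g' ->
    (forall P, P \in players P0 :\: A ->
       leval f P * leval g P = leval f' P * leval g' P) ->
    leval f P0 * leval g P0 = leval f' P0 * leval g' P0.

Definition strong_multiplication (t : int) : Prop :=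
  private t /\ product_reconstruction t.

Lemma reconstruction_threshold_unique r r' :
  is_reconstruction_threshold r -> is_reconstruction_threshold r' -> r = r'.
Proof. by move=> [h m] [h' m']; apply/le_anti; rewrite m ?m'. Qed.

Lemma privacy_threshold_unique t t' :
  is_privacy_threshold t -> is_privacy_threshold t' -> t = t'.
Proof. by move=> [l h m] [l' h' m']; apply/le_anti; rewrite m ?m'. Qed.

End Scheme.

(* Main.v *)
(** Over a finite field with q elements, a nonzero polynomial of degree at most d
    in x and at most q - 2 in y has a nonzero coefficient c(x) of some power of y;
    c vanishes at no more than d points x, and over each of the other
    q - 1 - d values of x in F* the polynomial in y is nonzero of degree
    less than q - 1, hence nonzero at some y in F*.  This gives (i) with d = a,
    and (ii).
    On the torus exponents of y can be reduced modulo q - 1, so a difference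
    of products of two elements of the span satisfies the same bound with
    d = 2a: its support cannot be contained in P0 together with t other
    points, which gives (iv).  For privacy, a set of b - 1 players is
    separated from P0 by a product of factors x - x_P and y - y_P, one for
    each player P; it lies in the span because the square with side b - 1
    lies in the trapezoid. *)

Require Import Defs.
From mathcomp Require Import all_boot all_order all_algebra.
From mathcomp Require Import boolp finfield zify lra.
Import Order.TTheory GRing.Theory Num.Theory.
Local Open Scope ring_scope.

Set Implicit Arguments.
Unset Strict Implicit.

(** * Extrema of bounded sets of integers *)

Lemma int_min_exists (P : int -> Prop) (lo hi : int) :
  (forall r, P r -> lo <= r) -> P hi ->
  exists r, [/\ P r, r <= hi & forall r', P r' -> r <= r'].
Proof.
move=> hlo hhi.
have shift r : P r -> r = lo + `|r - lo|%N%:Z.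
  by move/hlo; lia.
(* The predicate is shifted to the natural numbers and made boolean by classical logic, so that
   [ex_minnP] applies. *)
have ex : exists n, `[< P (lo + n%:Z) >].
  by exists `|hi - lo|%N; apply/asboolP; rewrite -shift.
case: (ex_minnP ex) => n /asboolP Pn min_n.
have min r' : P r' -> lo + n%:Z <= r'.
  move=> Pr'; rewrite (shift _ Pr') lerD2l lez_nat.
  by apply/min_n/asboolP; rewrite -shift.
by exists (lo + n%:Z); split=> //; exact: min.
Qed.

Lemma int_max_exists (P : int -> Prop) (lo hi : int) :
  (forall r, P r -> r <= hi) -> P lo ->
  exists r, [/\ P r, lo <= r & forall r', P r' -> r' <= r].
Proof.
move=> hhi hlo.
have [||r [Pr ler minr]] := @int_min_exists (fun r => P (- r)) (- hi) (- lo).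
- by move=> r /hhi; rewrite lerNl.
- by rewrite opprK.
exists (- r); split=> // [|r' Pr']; first by rewrite lerNr.
by rewrite lerNr; apply: minr; rewrite opprK.
Qed.

(** * Supports and values of Laurent polynomials *)

Section Laurent.
Variable F : fieldType.
Implicit Types (f g : laurent2 F) (U : int * int -> Prop) (P : F * F).

Lemma levalB f g P : leval f P - leval g P = leval (f - g) P.
Proof. by rewrite /leval raddfB. Qed.

Lemma leval0 P : leval 0 P = 0.
Proof. by rewrite /leval raddf0. Qed.

Lemma leval_sum (I : finType) (c : I -> F) (u : I -> int * int) P :
  leval (\sum_i c i *: << u i >>) P =
  \sum_i c i * (P.1 ^ (u i).1 * P.2 ^ (u i).2).
Proof.
rewrite /leval raddf_sum /=; apply: eq_bigr => i _.
suff -> : c i *: << u i >> = << c i *g u i >> by exact: mmapU.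
by apply/malgP => k; rewrite mcoeffZ !mcoeffU mulr_natr.
Qed.

Lemma mcoeff_monomial_sum (I : finType) (c : I -> F) (u : I -> int * int) v :
  (\sum_i c i *: << u i >>)@_v != 0 -> exists i, v = u i.
Proof.
rewrite raddf_sum /= => nz.
have /existsP[k /eqP->] : [exists k, v == u k]; last by exists k.
apply: contraNT nz => /existsPn ne; rewrite big1 // => k _.
by rewrite mcoeffZ mcoeffU eq_sym (negbTE (ne k)) mulr0.
Qed.

(** A family witnessing membership may repeat monomials; passing to the support removes this freedom
    and makes closure under differences immediate. *)
Lemma monomial_spanP U f :
  monomial_span U f <-> forall u, f@_u != 0 -> U u.
Proof.
split=> [[n [c [u [Uu ->]]]] v /mcoeff_monomial_sum[i ->] // | Uf].
pose s := finmap.enum_fset (msupp f).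
exists (size s), (fun i => f@_(s`_i)), (fun i => s`_i); split.
  by move=> i; apply: Uf; rewrite mcoeff_neq0; apply: mem_nth.
rewrite {1}[f]monalgE (big_nth 0) big_mkord; apply: eq_bigr => i _.
by apply/malgP => k; rewrite mcoeffZ !mcoeffU mulr_natr.
Qed.

Lemma monomial_spanB U f g :
  monomial_span U f -> monomial_span U g -> monomial_span U (f - g).
Proof.
move=> /monomial_spanP Uf /monomial_spanP Ug; apply/monomial_spanP => u.
rewrite mcoeffB; have [f0|/Uf//] := eqVneq f@_u 0.
by rewrite f0 sub0r oppr_eq0 => /Ug.
Qed.

Lemma monomial_span0 U : monomial_span U (0 : laurent2 F).
Proof. by apply/monomial_spanP => u; rewrite mcoeff0 eqxx. Qed.

Definition bipoly (m n : nat) (c : nat -> nat -> F) P : F :=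
  \sum_(i < m) \sum_(j < n) c i j * (P.1 ^+ i * P.2 ^+ j).

Lemma leval_bipoly U f (m n : nat) :
  (forall u, U u -> exists (i : 'I_m) (j : 'I_n), u = (i%:Z, j%:Z)) ->
  monomial_span U f ->
  leval f =1 bipoly m n (fun i j => f@_(i%:Z, j%:Z)).
Proof.
move=> box /monomial_spanP Uf P.
suff {1}-> : f = \sum_(v : 'I_m * 'I_n)
    f@_(v.1%:Z, v.2%:Z) *: << (v.1%:Z, v.2%:Z) >>.
  by rewrite leval_sum /bipoly pair_bigA.
apply/malgP => u; rewrite raddf_sum /=.
have [f0|nz] := eqVneq f@_u 0.
  rewrite f0 big1 // => v _; rewrite mcoeffZ mcoeffU.
  by case: eqP => [->|_]; rewrite ?f0 ?mul0r ?mulr0.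
have [i [j uE]] := box _ (Uf _ nz).
rewrite (bigD1 (i, j)) //= big1 ?addr0 => [|[k l] ne].
  by rewrite mcoeffZ mcoeffU uE eqxx mulr1.
rewrite mcoeffZ mcoeffU uE; case: eqP => [[ki lj]|_]; last by rewrite mulr0.
by case/eqP: ne; congr pair; apply: val_inj.
Qed.
End Laurent.

(** * Nonzeros of polynomial functions on the torus *)

Section Torus.
Variable F : finFieldType.
Implicit Types (f g : laurent2 F) (P : F * F).
Local Notation N := (#|F|.-1).

Lemma card_torus : #|torus F| = (N ^ 2)%N.
Proof.
have -> : torus F = setX [set~ 0] [set~ 0].
  by apply/setP => P; rewrite !inE.
by rewrite cardsX cardsC1.
Qed.

Lemma card_nonzero_nonroots (p : {poly F}) :
  p != 0 -> (N - (size p).-1 <= #|[set x : F | x != 0%R & ~~ root p x]|)%N.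
Proof.
move=> nz.
have := max_poly_roots nz (rs := enum [set x : F | x != 0 & root p x]).
rewrite enum_uniq -cardE => /(_ _ isT) lt.
have {}lt : (#|[set x : F | x != 0%R & root p x]| < size p)%N.
  by apply: lt; apply/allP => x; rewrite mem_enum inE => /andP[].
have : #|[set~ (0 : F)]| = N by exact: cardsC1.
have -> : [set~ (0 : F)] = [set x : F | x != 0 & root p x]
          :|: [set x : F | x != 0 & ~~ root p x].
  by apply/setP => x; rewrite !inE; case: (x == 0); case: root.
have [] := leq_card_setU [set x : F | x != 0 & root p x]
             [set x : F | x != 0 & ~~ root p x].
lia.
Qed.

Lemma bipoly_support (m : nat) (c : nat -> nat -> F) (i0 j0 : nat) :
  (i0 < m)%N -> (j0 < N)%N -> c i0 j0 != 0 ->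
  (N - m.-1 <= #|[set P in torus F | bipoly m N c P != 0%R]|)%N.
Proof.
move=> lti ltj nz.
(* [p] is the coefficient of y^j0, and [r x] is the polynomial in y obtained by fixing x. *)
pose p := \poly_(i < m) c i j0.
pose r x := \poly_(j < N) (\poly_(i < m) c i j).[x].
have rE x y : (r x).[y] = bipoly m N c (x, y).
  rewrite horner_poly /bipoly exchange_big; apply: eq_bigr => j _ /=.
  rewrite horner_poly mulr_suml; apply: eq_bigr => i _.
  by rewrite mulrA.
have p0 : p != 0.
  apply: contraNneq nz => /(congr1 (fun s : {poly F} => s`_i0)).
  by rewrite coef_poly lti coef0 => ->.
apply: (@leq_trans #|[set x : F | x != 0%R & ~~ root p x]|).
  apply: leq_trans (card_nonzero_nonroots p0).
  by have := size_poly m (fun i => c i j0); rewrite -/p; lia.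
(* Counting first coordinates of nonzeros suffices: one y is needed above each x outside the roots
   of [p]. *)
apply: leq_trans (leq_imset_card fst _); apply: subset_leq_card.
apply/subsetP => x; rewrite inE => /andP[x0 px].
have r0 : r x != 0.
  apply: contraNneq px => /(congr1 (fun s : {poly F} => s`_j0)).
  by rewrite coef_poly ltj coef0 /root => ->.
have /card_gt0P[y] : (0 < #|[set y : F | y != 0%R & ~~ root (r x) y]|)%N.
  apply: leq_trans (card_nonzero_nonroots r0).
  have := size_poly N (fun j => (\poly_(i < m) c i j).[x]); rewrite -/(r x).
  by have := size_poly_gt0 (r x); rewrite r0; lia.
rewrite inE => /andP[y0]; rewrite /root rE => rxy.
by apply/imsetP; exists (x, y) => //; rewrite !inE /= x0 y0.
Qed.

(** Agreement is required on the torus only, which leaves room to reduce exponents of y modulo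
    [N]. *)
Definition bipoly_fun (m : nat) (h : F * F -> F) : Prop :=
  exists c, {in torus F, h =1 bipoly m N c}.

Lemma bipoly_fun_support m h :
  bipoly_fun m h -> (exists2 P, P \in torus F & h P != 0) ->
  (N - m.-1 <= #|[set P in torus F | h P != 0%R]|)%N.
Proof.
move=> [c hE] [P0 TP0 nz].
have -> : [set P in torus F | h P != 0%R]
          = [set P in torus F | bipoly m N c P != 0].
  by apply/setP => P; rewrite [LHS]inE [RHS]inE; apply: andb_id2l => /hE->.
have /existsP[i /existsP[j cij]] :
    [exists i : 'I_m, [exists j : 'I_N, c i j != 0]].
  apply: contraNT nz => /existsPn c0.
  rewrite hE // /bipoly big1 // => i _; rewrite big1 // => j _.
  by have /existsPn/(_ j) := c0 i; rewrite negbK => /eqP->; rewrite mul0r.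
exact: bipoly_support cij.
Qed.

Lemma bipoly_fun_sum m (I : finType) (h : I -> F * F -> F) :
  (forall k, bipoly_fun m (h k)) -> bipoly_fun m (fun P => \sum_k h k P).
Proof.
move=> /fin_all_exists[c hE]; exists (fun i j => \sum_k c k i j) => P TP.
rewrite (eq_bigr _ (fun k _ => hE k P TP)) exchange_big; apply: eq_bigr => i _.
by rewrite exchange_big; apply: eq_bigr => j _; rewrite mulr_suml.
Qed.

Lemma bipoly_funB m h1 h2 :
  bipoly_fun m h1 -> bipoly_fun m h2 -> bipoly_fun m (fun P => h1 P - h2 P).
Proof.
move=> [c1 h1E] [c2 h2E]; exists (fun i j => c1 i j - c2 i j) => P TP.
rewrite h1E // h2E // -sumrB; apply: eq_bigr => i _.
by rewrite -sumrB; apply: eq_bigr => j _; rewrite mulrBl.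
Qed.

(** Nonzero y satisfy y^N = 1, so [j] is replaced by its remainder modulo [N]; the exponent of x is
    kept. *)
Lemma bipoly_fun_monomial m (a : F) (i j : nat) :
  (i < m)%N -> bipoly_fun m (fun P => a * (P.1 ^+ i * P.2 ^+ j)).
Proof.
move=> lti; exists (fun k l => a * ((k == i) && (l == (j %% N)%N))%:R) => P.
rewrite inE => /andP[_ y0].
have q1 : (1 < #|F|)%N := finRing_gt1 F.
have N0 : (0 < N)%N by lia.
have yN : P.2 ^+ N = 1.
  by apply: (mulIf y0); rewrite mul1r -exprSr prednK ?expf_card // ltnW.
rewrite /bipoly (bigD1 (Ordinal lti)) //= [X in _ + X]big1 => [|k ki].
  rewrite (bigD1 (Ordinal (ltn_pmod j N0))) //= !eqxx mulr1 big1 => [|l lj].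
    by rewrite !addr0 {1}(divn_eq j N) exprD mulnC exprM yN expr1n mul1r.
  by rewrite -val_eqE /= in lj; rewrite (negbTE lj) mulr0 mul0r.
rewrite -val_eqE /= in ki; rewrite big1 // => l _.
by rewrite (negbTE ki) mulr0 mul0r.
Qed.

(** The product of values is expanded pointwise: exponents of x add up to at most 2a, while those of
    y may reach [N] and are then reduced. *)
Lemma leval_mul_bipoly U f g (a : nat) :
  (forall u, U u -> exists (i : 'I_a.+1) (j : 'I_N), u = (i%:Z, j%:Z)) ->
  monomial_span U f -> monomial_span U g ->
  bipoly_fun (a + a).+1 (fun P => leval f P * leval g P).
Proof.
move=> box [k [c [u [Uu ->]]]] [l [d [v [Uv ->]]]].
have [e eE] : bipoly_fun (a + a).+1 (fun P =>
    \sum_(w : 'I_k * 'I_l) (c w.1 * (P.1 ^ (u w.1).1 * P.2 ^ (u w.1).2)) *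
                (d w.2 * (P.1 ^ (v w.2).1 * P.2 ^ (v w.2).2))).
  apply: bipoly_fun_sum => -[s t] /=.
  have [i [j ->]] := box _ (Uu s); have [i' [j' ->]] := box _ (Uv t).
  have [|e eE] := @bipoly_fun_monomial (a + a).+1 (c s * d t) (i + i') (j + j').
    by have := ltn_ord i; have := ltn_ord i'; lia.
  exists e => P TP; rewrite -eE // !exprD /=.
  by rewrite -!exprnP mulrACA; congr (_ * _); rewrite mulrACA.
by exists e => P TP; rewrite -eE // !leval_sum big_distrlr pair_bigA.
Qed.
End Torus.

(** * Lattice points of the trapezoid *)

Lemma trapezoidP (R : realType) (a b q : int) (x y : R) :
  trapezoid R a b q (x, y) <->
  exists w0 w1 w2 w3 : R,
    [/\ [/\ 0 <= w0, 0 <= w1, 0 <= w2 & 0 <= w3], w0 + w1 + w2 + w3 = 1,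
        x = w1 * a%:~R + w2 * b%:~R & y = (w2 + w3) * (q - 2)%:~R].
Proof.
split=> [[w [w_ge0 w_sum wE]] | [w0 [w1 [w2 [w3 [[h0 h1 h2 h3] w_sum xE yE]]]]]].
  exists (w ord0), (w (lift ord0 ord0)), (w (lift ord0 (lift ord0 ord0))),
    (w (lift ord0 (lift ord0 (lift ord0 ord0)))).
  move: w_sum wE; rewrite !big_ord_recl !big_ord0 /= => w_sum [-> ->].
  split; first by split; apply: w_ge0.
  - by rewrite -w_sum addr0 !addrA.
  - by rewrite /= !scaler0 addr0 add0r addr0.
  - by rewrite /= !scaler0 !add0r addr0 mulrDl.
exists (fun i => nth 0 [:: w0; w1; w2; w3] i); split=> /=.
- by case=> -[|[|[|[|]]]].
- by rewrite !big_ord_recl big_ord0 /= addr0 -w_sum !addrA.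
- rewrite !big_ord_recl big_ord0 /= xE yE; congr pair.
    by rewrite /= !scaler0 addr0 add0r addr0.
  by rewrite /= !scaler0 !add0r addr0 mulrDl.
Qed.

Section Trapezoid.
Variables (R : realType) (a b q : int).
Hypotheses (b_ge0 : 0 <= b) (le_ba : b <= a) (q_ge2 : 0 <= q - 2).
Local Notation K := (lattice_points (trapezoid R a b q)).

Lemma trapezoid_bounds u : K u -> 0 <= u.1 <= a /\ 0 <= u.2 <= q - 2.
Proof.
move=> /trapezoidP[w0 [w1 [w2 [w3 [[h0 h1 h2 h3] w_sum xE yE]]]]].
have bR : 0 <= b%:~R :> R by rewrite ler0z.
have abR : b%:~R <= a%:~R :> R by rewrite ler_int.
have qR : 0 <= (q - 2)%:~R :> R by rewrite ler0z.
(* The weights are nonnegative with sum 1 and [b <= a], so w1 a + w2 b is at most a; the other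
   bounds are similar. *)
by split; apply/andP; split;
   rewrite -?(ler0z R) -?(ler_int R) ?xE ?yE; nra.
Qed.

Lemma origin_trapezoid : K (0, 0).
Proof.
apply/trapezoidP; exists 1, 0, 0, 0.
by split; rewrite ?ler01 ?mul0r ?addr0 ?mul0r.
Qed.

(** Since u.1 is at most b and b at most a, the vertical line through [u] meets both horizontal
    edges, and [u] lies between the two meeting points. *)
Lemma box_trapezoid u :
  0 < b -> 0 < q - 2 -> 0 <= u.1 <= b -> 0 <= u.2 <= q - 2 -> K u.
Proof.
move=> b_gt0 q_gt2 /andP[x_ge0 x_le] /andP[y_ge0 y_le]; apply/trapezoidP.
have bR : 0 < b%:~R :> R by rewrite ltr0z.
have aR : 0 < a%:~R :> R by rewrite ltr0z (lt_le_trans b_gt0).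
have qR : 0 < (q - 2)%:~R :> R by rewrite ltr0z.
have frac_itv (k n : int) : 0 <= k -> k <= n -> 0 < n%:~R :> R ->
    0 <= (k%:~R / n%:~R : R) <= 1.
  move=> k0 kn n0; rewrite divr_ge0 ?ler0z ?(ltW n0) ?(le_trans k0) //=.
  by rewrite ler_pdivrMr // mul1r ler_int.
have /andP[al0 al1] := frac_itv _ _ x_ge0 (le_trans x_le le_ba) aR.
have /andP[be0 be1] := frac_itv _ _ x_ge0 x_le bR.
have /andP[mu0 mu1] := frac_itv _ _ y_ge0 y_le qR.
have alE : u.1%:~R / a%:~R * a%:~R = u.1%:~R :> R by rewrite divfK ?gt_eqF.
have beE : u.1%:~R / b%:~R * b%:~R = u.1%:~R :> R by rewrite divfK ?gt_eqF.
have muE : u.2%:~R / (q - 2)%:~R * (q - 2)%:~R = u.2%:~R :> R.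
  by rewrite divfK ?gt_eqF.
move: al0 al1 be0 be1 mu0 mu1 alE beE muE.
set al := _ / a%:~R; set be := _ / b%:~R; set mu := _ / _.
move=> al0 al1 be0 be1 mu0 mu1 alE beE muE; clearbody al be mu.
(* [al] and [be] locate the meeting points on the bottom and top edges, and [mu] is the relative
   height of [u] between them. *)
exists ((1 - mu) * (1 - al)), ((1 - mu) * al), (mu * be), (mu * (1 - be)).
split; first by split; rewrite mulr_ge0 ?subr_ge0.
- lra.
- by rewrite -!mulrA alE beE -mulrDl subrK mul1r.
- by rewrite -mulrDr addrC subrK mulr1 muE.
Qed.
End Trapezoid.

(** * Separating polynomials and bounds for a general exponent set *)

Section PolynomialProduct.
Variable F : fieldType.

Lemma poly_mul_leval (U : int * int -> Prop) (p r : {poly F}) :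
  (forall i j : nat, (i < size p)%N -> (j < size r)%N -> U (i%:Z, j%:Z)) ->
  exists2 f : laurent2 F, monomial_span U f &
    forall P, leval f P = p.[P.1] * r.[P.2].
Proof.
move=> Upr.
exists (\sum_(w : 'I_(size p) * 'I_(size r))
           (p`_w.1 * r`_w.2) *: << (w.1%:Z, w.2%:Z) >>).
  by apply/monomial_spanP => u /mcoeff_monomial_sum[[i j] ->]; exact: Upr.
move=> P; rewrite leval_sum !horner_coef big_distrlr pair_bigA.
by apply: eq_bigr => w _; rewrite /= -!exprnP mulrACA.
Qed.

End PolynomialProduct.

Section Separation.
Variable F : finFieldType.

(** A point of [S] whose first coordinate differs from that of [P0] gives a factor of [p]; any other
    point must differ in the second coordinate and gives a factor of [r]. *)
Lemma separating_polys (S : {set F * F}) (P0 : F * F) :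
  P0 \notin S ->
  exists p r : {poly F},
    [/\ (size p <= #|S|.+1)%N, (size r <= #|S|.+1)%N,
        forall P, P \in S -> p.[P.1] * r.[P.2] = 0 & p.[P0.1] * r.[P0.2] != 0].
Proof.
move=> S0; pose S1 := [set P in S | P.1 != P0.1].
pose S2 := [set P in S | P.1 == P0.1].
exists (\prod_(P in S1) ('X - P.1%:P)), (\prod_(P in S2) ('X - P.2%:P)).
have hornerE (T : {set F * F}) (c : F * F -> F) x :
    (\prod_(P in T) ('X - (c P)%:P)).[x] = \prod_(P in T) (x - c P).
  by rewrite horner_prod; apply: eq_bigr => P _; rewrite hornerXsubC.
have size_le (T : {set F * F}) (c : F * F -> F) : T \subset S ->
    (size (\prod_(P in T) ('X - (c P)%:P))%R <= #|S|.+1)%N.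
  rewrite -big_enum /= size_prod_XsubC -cardE ltnS; exact: subset_leq_card.
split.
- by apply: size_le; apply/subsetP => P; rewrite inE => /andP[].
- by apply: size_le; apply/subsetP => P; rewrite inE => /andP[].
- move=> P SP; rewrite !hornerE; apply/eqP; rewrite mulf_eq0; apply/orP.
  have [e|ne] := eqVneq P.1 P0.1; [right|left]; apply/prodf_eq0; exists P.
  1,3: by rewrite inE SP ?e ?eqxx.
  1,2: by rewrite subr_eq0.
- rewrite !hornerE mulf_neq0 //; apply/prodf_neq0 => P; rewrite inE subr_eq0.
    by case/andP; rewrite eq_sym.
  case/andP=> SP /eqP e1; apply: contraNneq S0 => e2.
  by rewrite [P0]surjective_pairing e2 -e1 -surjective_pairing.
Qed.

Variables (U : int * int -> Prop) (P0 : F * F).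
Local Notation N := (#|F|.-1).

(** The torus splits into zeros and nonzeros of [f], and [bipoly_support] bounds the nonzeros from
    below. *)
Lemma card_zeros (f : laurent2 F) (a : nat) :
  (forall u, U u -> exists (i : 'I_a.+1) (j : 'I_N), u = (i%:Z, j%:Z)) ->
  monomial_span U f -> f <> 0 ->
  (#|[set P in torus F | leval f P == 0%R]| + (N - a) <= N ^ 2)%N.
Proof.
move=> box Uf f0.
have [u nz] : exists u, f@_u != 0.
  apply/not_existsP => all0; apply: f0; apply/malgP => u.
  by rewrite mcoeff0; apply/eqP/negPn/negP; exact: all0.
have [i [j uE]] := box _ ((monomial_spanP U f).1 Uf _ nz).
rewrite uE in nz.
have supp := bipoly_support (c := fun i j => f@_(i%:Z, j%:Z)) (ltn_ord i)
  (ltn_ord j) nz.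
rewrite -card_torus -(cardsID [set P | leval f P == 0] (torus F)).
apply: leq_add.
  by apply: subset_leq_card; apply/subsetP => P; rewrite !inE.
apply: leq_trans supp _; apply: subset_leq_card; apply/subsetP => P.
by rewrite !inE -(leval_bipoly box Uf) andbC.
Qed.

(** The constants 1 and 0 both lie in the span and differ at [P0]. This later bounds the
    reconstruction threshold from below. *)
Lemma empty_determines : U (0, 0) -> ~ determines U P0 set0.
Proof.
move=> U0 /(_ << (0, 0) >> 0) det.
have : leval (<< (0, 0) >> : laurent2 F) P0 = leval 0 P0.
  apply: det; [|exact: monomial_span0|by move=> P; rewrite inE].
  apply/monomial_spanP => u; rewrite mcoeffU.
  by case: ((0, 0) =P u) => [<- //|_]; rewrite mulr0n eqxx.
rewrite leval0 /leval mmapU /= mul1r mul1r => /eqP.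
by rewrite oner_eq0.
Qed.

(** The separating product and 0 give the same shares on [S] but different secrets. *)
Lemma private_box (b : nat) :
  (forall i j : nat, (i <= b)%N -> (j <= b)%N -> U (i%:Z, j%:Z)) ->
  private U P0 b%:Z.
Proof.
move=> box S sub; rewrite lez_nat => leS det.
have S0 : P0 \notin S.
  by apply: contraTN isT => /(subsetP sub); rewrite !inE eqxx.
have [p [r [szp szr zero nz]]] := separating_polys S0.
have [|f Uf fE] := @poly_mul_leval _ U p r.
  move=> i j lti ltj; apply: box; rewrite -ltnS.
    by apply: leq_trans lti _; apply: leq_trans szp _.
  by apply: leq_trans ltj _; apply: leq_trans szr _.
case/eqP: nz; rewrite -fE (det f 0 Uf (@monomial_span0 _ U)) ?leval0 // => P /zero.
by rewrite fE leval0.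
Qed.

Lemma product_reconstruction_box (a : nat) (t : int) :
  (forall u, U u -> exists (i : 'I_a.+1) (j : 'I_N), u = (i%:Z, j%:Z)) ->
  P0 \in torus F -> t + 1 < N%:Z - (a + a)%:Z ->
  product_reconstruction U P0 t.
Proof.
move=> box TP0 lt_t S sub leS f g f' g' Uf Ug Uf' Ug' eq_fg.
apply/eqP; rewrite -subr_eq0; apply: contraT => nz.
have bip := bipoly_funB (leval_mul_bipoly box Uf Ug)
                        (leval_mul_bipoly box Uf' Ug').
have := bipoly_fun_support bip (ex_intro2 _ _ P0 TP0 nz).
set Z := finset _ => leZ.
(* The two products agree at every player outside [S], so [Z] is contained in [P0 |: S]; this is too
   small for the lower bound [leZ]. *)
have : (#|Z| <= #|S|.+1)%N.
  apply: (@leq_trans #|P0 |: S|); last by rewrite cardsU1 -add1n leq_add2r leq_b1.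
  apply: subset_leq_card; apply/subsetP => P; rewrite inE => /andP[TP].
  apply: contraNT; rewrite !inE negb_or => /andP[ne nS].
  by rewrite subr_eq0; apply/eqP/eq_fg; rewrite in_setD nS in_setD1 ne.
lia.
Qed.

End Separation.

(** * Specialization to the trapezoid *)

Unset Implicit Arguments.

Theorem theorem4p5 (R : realType) (F : finFieldType) (q : nat) (hq : #|F| = q)
    (a b : int) (hb : 0 <= b) (hab : b <= a) (ha : a <= q%:Z - 2)
    (U : int * int -> Prop)
    (hU : U = lattice_points (trapezoid R a b q%:Z))
    (P0 : F * F) (hP0 : P0 \in torus F) :
  [/\ (forall f : laurent2 F, monomial_span U f -> f <> 0 ->
         #|[set P in torus F | leval f P == 0]|%:Z
           <= (q%:Z - 1) ^+ 2 - (q%:Z - 1 - a)),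
      (exists r : int, is_reconstruction_threshold U P0 r /\
         r <= 1 + (q%:Z - 1) ^+ 2 - (q%:Z - 1 - a)),
      (exists t : int, is_privacy_threshold U P0 t /\ b - 1 <= t) &
      (2 * a <= q%:Z - 2 ->
       forall t : int, t <= Num.min (b - 1) (q%:Z - 2 - 2 * a - 1) ->
         strong_multiplication U P0 t)].
Proof.
have q_gt1 : (1 < #|F|)%N := finRing_gt1 F.
set N := #|F|.-1.
have qN : q%:Z = N%:Z + 1 by rewrite /N; lia.
have q_ge2 : 0 <= q%:Z - 2 by lia.
have [A aE] : exists A : nat, a = A%:Z by exists `|a|%N; lia.
have box u : U u -> exists (i : 'I_A.+1) (j : 'I_N), u = (i%:Z, j%:Z).
  rewrite hU => /(trapezoid_bounds hb hab q_ge2)[u1 u2].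
  have lt1 : (`|u.1| < A.+1)%N by lia.
  have lt2 : (`|u.2| < N)%N by lia.
  exists (Ordinal lt1), (Ordinal lt2); rewrite [LHS]surjective_pairing /=.
  by congr pair; lia.
have sqE : (q%:Z - 1) ^+ 2 = (N ^ 2)%N%:Z by rewrite qN addrK expr2 -PoszM mulnn.
have zeros f : monomial_span U f -> f <> 0 ->
    #|[set P in torus F | leval f P == 0]|%:Z
      <= (q%:Z - 1) ^+ 2 - (q%:Z - 1 - a).
  by move=> Uf f0; have := card_zeros box Uf f0; rewrite sqE -/N; lia.
(* If f and f' agree on [S] but differ, then f - f' is nonzero with at least #|S| zeros, one more
   than [zeros] allows. *)
have rec : reconstructs U P0 (1 + (q%:Z - 1) ^+ 2 - (q%:Z - 1 - a)).
  move=> S sub leS f f' Uf Uf' eqS; apply/eqP; rewrite -subr_eq0 levalB.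
  have [->|/eqP ne] := eqVneq f f'; first by rewrite subrr leval0.
  have := zeros _ (monomial_spanB Uf Uf') (fun e => ne (subr0_eq e)).
  have : (#|S| <= #|[set P in torus F | leval (f - f')%R P == 0%R]|)%N.
    apply: subset_leq_card; apply/subsetP => P SP.
    have /setD1P[_ TP] := subsetP sub P SP.
    by rewrite inE TP -levalB eqS ?subrr ?eqxx.
  lia.
have priv t : t <= b - 1 -> private U P0 t.
  (* For b = 0 the bound on t is negative and no set qualifies. Otherwise b <= a <= q - 2 makes q -
     2 positive and puts the square of side b - 1 inside the trapezoid. *)
  case: (ltrP 0 b) => b0 le_t S sub leS; last by lia.
  apply: (private_box (b := `|b - 1|%N)) sub _; last by lia.
  move=> i j lei lej; rewrite hU; apply: box_trapezoid => //=; lia.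
split=> //.
(* The lower bound 1 holds because a reconstructing r < 1 would let the empty set determine the
   secret. *)
- have [r|r [recr ler minr]] := int_min_exists (lo := 1) _ rec.
    move=> recr; rewrite leNgt; apply/negP => r1.
    apply: (@empty_determines F U P0);
      first by rewrite hU; exact: origin_trapezoid.
    by apply: recr; rewrite ?sub0set // cards0; lia.
  by exists r.
- have cardP : #|players P0| = (N ^ 2).-1.
    by have := cardsD1 P0 (torus F); rewrite hP0 card_torus -/N => ->.
  have [|| t [[tn tpriv] le_t maxt]] := int_max_exists
      (P := fun t => t <= #|players P0|%:Z /\ private U P0 t)
      (hi := #|players P0|%:Z) (lo := b - 1).
  + by move=> t [].
  (* [b - 1] is a candidate: b <= q - 2 keeps it below the number of players. *)
  + by split; [rewrite cardP; nia | exact: priv].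
  by exists t; split=> //; split=> // t' t'n pr; apply: maxt.
- move=> a2 t; rewrite le_min => /andP[tb ta]; split; first exact: priv.
  (* As q - 2 = N - 1, the bound on t gives t + 1 <= N - 2a - 1. *)
  by apply: (product_reconstruction_box box hP0); rewrite -/N; lia.
Qed.
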